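(* Let $K$ be a number field of degree $n$ over $\mathbb{Q}$, and let $\Delta^2(u_1,\dots,u_n)$ be the discriminant of the fundamental equation of $K$ with its numerical factor removed. Then a rational prime $p$ is a common inessential divisor of the equation discriminants for $K$ if and only if the primitive form $\Delta(u_1,\dots,u_n)$ of degree $\frac12n(n-1)$ contains the divisor system $(p;u_1^p-u_1,\dots,u_n^p-u_n)$, that is, if and only if there is an equation $$\Delta(u_1,\dots,u_n)=U_0\,p+U_1(u_1^p-u_1)+\cdots+U_n(u_n^p-u_n),$$ where $U_0,U_1,\dots,U_n$ are polynomials in $u_1,\dots,u_n$ with integer coefficients.
   Context: Let $\xi_1,\dots,\xi_n$ be an integral basis of the ring of integers $\mathcal{O}$ of $K$, $u_1,\dots,u_n$ indeterminates, $w_0=u_1\xi_1+\cdots+u_n\xi_n$ the fundamental form and $w_0,\dots,w_{n-1}$ its conjugates (replace the $\xi_i$ by their conjugates under the $n$ embeddings of $K$). The discriminant of the fundamental equation $\prod_j(w-w_j)=0$ is $\Delta(u_1,\dots,u_n)^2\cdot D$, where $D$ is the discriminant of $K$ (the numerical factor) and $\Delta$ is a homogeneous polynomial of degree $\frac{n(n-1)}2$ with integer coefficients having no common divisor (defined up to sign). For $\xi_0\in\mathcal{O}$ write $\xi_0^k=\sum_i a_{ik}\xi_i$ ($k=0,\dots,n-1$), $a_{ik}\in\mathbb{Z}$. The equation discriminant of $\xi_0$ (the discriminant of its degree $n$ characteristic equation) equals $|a_{ik}|^2D$. The prime $p$ is a common inessential divisor of the equation discriminants if $p$ divides the determinant $|a_{ik}|$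 for every $\xi_0\in\mathcal{O}$. *)

(* Defs.v *)
From HB Require Import structures.
From mathcomp Require Import all_boot all_order all_algebra all_field.
From mathcomp Require Import mpoly.

Set Implicit Arguments.
Unset Strict Implicit.
Unset Printing Implicit Defensive.

Import GRing.Theory.
Local Open Scope ring_scope.

Definition is_algebraic_integer (K : fieldExtType rat) (x : K) : Prop :=
  integralOver (intr : int -> K) x.

Definition integral_basis (K : fieldExtType rat) (n : nat) (xi : 'I_n -> K) :
    Prop :=
  (forall i, is_algebraic_integer (xi i)) /\
  (forall x : K, is_algebraic_integer x ->
     exists! a : 'rV[int]_n, x = \sum_(i < n) (a 0 i)%:~R * xi i).

(* [sigma] lists every field embedding of K into the algebraic complex numbers
   exactly once.  Morphisms are compared as functions, since the equality of
   [{rmorphism _ -> _}] also involves the proof components. *)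
Definition all_embeddings (K : fieldExtType rat) (n : nat)
    (sigma : 'I_n -> {rmorphism K -> algC}) : Prop :=
  (forall i j, sigma i =1 sigma j -> i = j) /\
  (forall tau : {rmorphism K -> algC}, exists i, tau =1 sigma i).

(* The discriminant of the monic equation whose roots, with multiplicity, are
   w 0, ..., w (n - 1). *)
Definition root_discriminant (R : comNzRingType) (n : nat) (w : 'I_n -> R) : R :=
  \prod_(i < n) \prod_(j < n | (i < j)%N) (w i - w j) ^+ 2.

(* The j-th conjugate u_1 xi_1^(j) + ... + u_n xi_n^(j) of the fundamental
   form; the indeterminate u_i is 'X_i. *)
Definition fundamental_conjugate (K : fieldExtType rat) (n : nat)
    (sigma : 'I_n -> {rmorphism K -> algC}) (xi : 'I_n -> K) (j : 'I_n) :
    {mpoly algC[n]} :=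
  \sum_(i < n) (sigma j (xi i))%:MP * 'X_i.

Definition fundamental_discriminant (K : fieldExtType rat) (n : nat)
    (sigma : 'I_n -> {rmorphism K -> algC}) (xi : 'I_n -> K) :
    {mpoly algC[n]} :=
  root_discriminant (fundamental_conjugate sigma xi).

(* The discriminant of K when xi is an integral basis and sigma enumerates the
   embeddings. *)
Definition field_discriminant (K : fieldExtType rat) (n : nat)
    (sigma : 'I_n -> {rmorphism K -> algC}) (xi : 'I_n -> K) : algC :=
  (\det (\matrix_(i < n, j < n) sigma j (xi i))) ^+ 2.

Definition primitive_mpoly (n : nat) (P : {mpoly int[n]}) : Prop :=
  forall d : int, (forall m : 'X_{1..n}, (d %| P@_m)%Z) -> d \is a GRing.unit.

(* Delta ^ 2 is the discriminant of the fundamental equation freed of its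
   numerical factor; this determines Delta up to sign. *)
Definition is_fundamental_Delta (K : fieldExtType rat) (n : nat)
    (sigma : 'I_n -> {rmorphism K -> algC}) (xi : 'I_n -> K)
    (Delta : {mpoly int[n]}) : Prop :=
  [/\ Delta \is ((n * n.-1)./2).-homog,
      primitive_mpoly Delta
    & fundamental_discriminant sigma xi =
        (map_mpoly (intr : int -> algC) Delta) ^+ 2 *
        (field_discriminant sigma xi)%:MP].

Definition common_inessential_divisor (K : fieldExtType rat) (n : nat)
    (xi : 'I_n -> K) (p : nat) : Prop :=
  forall x : K, is_algebraic_integer x ->
  forall a : 'M[int]_n,
    (forall k : 'I_n, x ^+ k = \sum_(i < n) (a i k)%:~R * xi i) ->
    (p%:Z %| \det a)%Z.

(* Main.v *)
Require Import Defs.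
From HB Require Import structures.
From mathcomp Require Import all_boot all_order all_algebra all_field.
From mathcomp Require Import mpoly.

Set Implicit Arguments.
Unset Strict Implicit.
Unset Printing Implicit Defensive.

Import GRing.Theory.
Local Open Scope ring_scope.

(** Both conditions say that p divides every integer value of Delta.

    Let x = sum_i c_i xi_i be an integer of K and let a be the matrix of its
    powers 1, x, ..., x^(n-1) in the basis xi.  Applying the embeddings sigma_j
    to these powers factors the Vandermonde matrix of the conjugates of x as
    a^T (sigma_j(xi_i)), so the discriminant of the conjugates is
    det(a)^2 D.  On the other hand it is the fundamental discriminant evaluated
    at u = c, that is Delta(c)^2 D.  Since D is nonzero,
    Delta(c)^2 = det(a)^2 ([Delta_det_powers]), and p divides det(a) if and
    only if it divides Delta(c).  D is nonzero because the fundamental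
    discriminant is: two equal conjugate forms would give two embeddings that
    agree on xi, and xi spans K over the rationals.

    It remains to see that an integer polynomial P takes only multiples of p as
    values if and only if it lies in the ideal (p, u_1^p - u_1, ...,
    u_n^p - u_n) ([mpoly_dvd_values]).  One direction is Fermat's little
    theorem.  For the other, reduce modulo p: over a finite field F of order q,
    a polynomial that vanishes on F^n lies in the ideal J of the u_i^q - u_i
    ([vanishing_mpoly_frobenius_ideal]).  Indeed, modulo J, the indicator
    polynomials L_c of the points c of F^n sum to 1, and P L_c is congruent to
    P(c) L_c; hence P is congruent to the sum of the P(c) L_c, which is 0. *)

(** * Polynomials modulo the ideal of the u_i^q - u_i *)

Definition frobenius_ideal (R : comNzRingType) (n q : nat)
    (P : {mpoly R[n]}) : Prop :=
  exists U : 'I_n -> {mpoly R[n]}, P = \sum_(i < n) U i * ('X_i ^+ q - 'X_i).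

Section FrobeniusIdeal.

Variables (R : comNzRingType) (n q : nat).
Implicit Types P Q A B : {mpoly R[n]}.
Local Notation J := (@frobenius_ideal R n q).

Lemma frobenius_ideal0 : J 0.
Proof. by exists (fun=> 0); rewrite big1 // => i _; rewrite mul0r. Qed.

Lemma frobenius_idealD P Q : J P -> J Q -> J (P + Q).
Proof.
move=> [U ->] [V ->]; exists (fun i => U i + V i).
by rewrite -big_split; apply: eq_bigr => i _; rewrite mulrDl.
Qed.

Lemma frobenius_idealMl P Q : J P -> J (Q * P).
Proof.
move=> [U ->]; exists (fun i => Q * U i).
by rewrite big_distrr; apply: eq_bigr => i _ /=; rewrite mulrA.
Qed.

Lemma frobenius_ideal_gen (i : 'I_n) : J ('X_i ^+ q - 'X_i).
Proof.
exists (fun j => (j == i)%:R); rewrite (bigD1 i) //= eqxx mul1r big1 ?addr0 //.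
by move=> j /negPf->; rewrite mul0r.
Qed.

Lemma frobenius_ideal_sum (I : finType) (F : I -> {mpoly R[n]}) :
  (forall i, J (F i)) -> J (\sum_i F i).
Proof.
move=> JF; apply: big_ind => // [|A B]; first exact: frobenius_ideal0.
exact: frobenius_idealD.
Qed.

Lemma frobenius_ideal_prod1 (I : finType) (F : I -> {mpoly R[n]}) :
  (forall i, J (F i - 1)) -> J (\prod_i F i - 1).
Proof.
move=> JF; apply: (big_ind (fun A => J (A - 1))) => // [|A B JA JB].
  by rewrite subrr; exact: frobenius_ideal0.
have -> : A * B - 1 = B * (A - 1) + (B - 1).
  by rewrite mulrBr mulr1 [B * A]mulrC addrA subrK.
by apply: frobenius_idealD => //; apply: frobenius_idealMl.
Qed.

(** The polynomials P with (P - P(c)) A in J form a subring that contains the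
    constants; it is everything once it contains the indeterminates.  It
    applies to the indicator polynomial A of the point c. *)
Lemma frobenius_ideal_localize (c : 'I_n -> R) A :
    (forall i, J (('X_i - (c i)%:MP) * A)) ->
  forall P, J ((P - P.@[c]%:MP) * A).
Proof.
move=> JX; pose S P := J ((P - P.@[c]%:MP) * A).
have SC a : S a%:MP.
  by rewrite /S mevalC subrr mul0r; exact: frobenius_ideal0.
have SD P Q : S P -> S Q -> S (P + Q).
  rewrite /S mevalD mpolyCD opprD addrACA [(_ + _ + _) * A]mulrDl.
  exact: frobenius_idealD.
have SM P Q : S P -> S Q -> S (P * Q).
  move=> SP SQ; rewrite /S mevalM mpolyCM.
  have -> : (P * Q - P.@[c]%:MP * Q.@[c]%:MP) * A =
            Q * ((P - P.@[c]%:MP) * A) + P.@[c]%:MP * ((Q - Q.@[c]%:MP) * A).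
    rewrite !mulrA -mulrDl; congr (_ * A).
    by rewrite !mulrBr [Q * P]mulrC [Q * _]mulrC addrA subrK.
  by apply: frobenius_idealD; apply: frobenius_idealMl.
apply: (mpolyind (P := S)) => [|a m P _ _ IH]; first exact: (SC 0).
apply: SD => //; rewrite -mul_mpolyC; apply: (SM); first exact: SC.
rewrite mpolyXE_id; apply: (big_ind S) => [|P1 P2|i _]; [exact: (SC 1) | exact: SM |].
elim: (m i) => [|k IHk]; first exact: (SC 1).
by rewrite exprS; apply: SM => //; rewrite /S mevalXU; exact: JX.
Qed.

End FrobeniusIdeal.

(** * Polynomials that vanish on a finite field *)

Section FiniteField.

Variable F : finFieldType.

(** Over F, 'X^#|F| - 'X is the product of all the 'X - a. *)
Lemma vanishing_poly_dvd (f : {poly F}) :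
  (forall a, f.[a] = 0) -> exists g, f = g * ('X^#|F| - 'X).
Proof.
move=> f0; rewrite finField_genPoly -big_enum /=.
apply: uniq_roots_prod_XsubC; last by rewrite uniq_rootsE enum_uniq.
by apply/allP => a _; apply/rootP.
Qed.

(** Transfers identities between univariate functions on F to congruences in
    one indeterminate, so that indicator polynomials only need to be
    evaluated. *)
Lemma vanishing_poly_frobenius_ideal n (i : 'I_n) (f : {poly F}) :
    (forall a, f.[a] = 0) ->
  frobenius_ideal #|F| (horner_alg ('X_i : {mpoly F[n]}) f).
Proof.
move=> /vanishing_poly_dvd[g ->].
rewrite rmorphM rmorphB rmorphXn /= horner_algX.
by apply: frobenius_idealMl; exact: frobenius_ideal_gen.
Qed.

Definition point_poly (a : F) : {poly F} := 1 - ('X - a%:P) ^+ #|F|.-1.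

(** Fermat in F: (b - a)^(#|F| - 1) is 1 unless b = a. *)
Lemma horner_point_poly (a b : F) : (point_poly a).[b] = (b == a)%:R.
Proof.
rewrite /point_poly !hornerE.
have cardF : #|F| = #|F|.-1.+1 by rewrite prednK // ltnW // finNzRing_gt1.
have [->|neq_ba] := eqVneq b a.
  by rewrite subrr expr0n -subn1 subn_eq0 leqNgt finNzRing_gt1 subr0.
apply/eqP; rewrite subr_eq0 eq_sym; apply/eqP.
have nz_ba : b - a != 0 by rewrite subr_eq0.
by apply: (mulfI nz_ba); rewrite -exprS -cardF expf_card mulr1.
Qed.

(** By Lagrange interpolation: the indicator polynomials L of the points give a
    partition of unity modulo the ideal, and P is congruent to P(c) = 0 on
    each piece. *)
Theorem vanishing_mpoly_frobenius_ideal n (P : {mpoly F[n]}) :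
  (forall c : 'I_n -> F, P.@[c] = 0) -> frobenius_ideal #|F| P.
Proof.
move=> P0; pose X (i : 'I_n) : {mpoly F[n]} := 'X_i.
pose L (c : {ffun 'I_n -> F}) := \prod_i horner_alg (X i) (point_poly (c i)).
have JL c : frobenius_ideal #|F| (P * L c).
  have -> : P * L c = (P - P.@[c]%:MP) * L c by rewrite P0 mpolyC0 subr0.
  apply: frobenius_ideal_localize => i.
  rewrite /L (bigD1 i) //= mulrA mulrC; apply: frobenius_idealMl.
  have -> : 'X_i - (c i)%:MP = horner_alg (X i) ('X - (c i)%:P).
    by rewrite rmorphB /= horner_algX horner_algC -mul_mpolyC mulr1.
  rewrite -rmorphM; apply: vanishing_poly_frobenius_ideal => a.
  rewrite hornerM horner_point_poly hornerXsubC.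
  by case: eqP => [->|_]; rewrite ?subrr ?mul0r ?mulr0.
(* Expand the product over i of the sums over a of the indicators of a. *)
have JL1 : frobenius_ideal #|F| (\sum_c L c - 1).
  rewrite /L -(bigA_distr_bigA (fun i a => horner_alg (X i) (point_poly a))).
  apply: frobenius_ideal_prod1 => i.
  rewrite -rmorph_sum -(rmorph1 (horner_alg (X i))) -rmorphB.
  apply: vanishing_poly_frobenius_ideal => a.
  rewrite hornerD hornerN hornerC horner_sum (bigD1 a) //= big1 => [|b].
    by rewrite horner_point_poly eqxx addr0 subrr.
  by rewrite horner_point_poly eq_sym => /negPf->.
have -> : P = \sum_c P * L c + - P * (\sum_c L c - 1).
  by rewrite -mulr_sumr mulNr mulrBr mulr1 opprB addrC subrK.
apply: frobenius_idealD; last exact: frobenius_idealMl.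
exact: frobenius_ideal_sum.
Qed.

End FiniteField.

(** * Reduction of integer polynomials modulo p *)

Lemma meval_map_int (S : comNzRingType) n (c : 'I_n -> int)
    (P : {mpoly int[n]}) :
  (map_mpoly (intr : int -> S) P).@[fun i => (c i)%:~R] = (P.@[c])%:~R.
Proof.
elim/mpolyind: P => [|a m P _ _ IH]; first by rewrite rmorph0 !meval0.
rewrite rmorphD /= !mevalD IH intrD map_mpolyZ map_mpolyX !mevalZ !mevalX.
rewrite intrM rmorph_prod; congr (_ * _ + _).
by apply: eq_bigr => i _; rewrite rmorphXn.
Qed.

Section ReductionModP.

Variables (n p : nat).
Hypothesis p_prime : prime p.
Local Notation red := (map_mpoly (intr : int -> 'F_p)).

Lemma intr_Fp_eq0 (z : int) : ((z%:~R : 'F_p) == 0) = (p%:Z %| z)%Z.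
Proof. by rewrite (dvdz_pcharf (pchar_Fp p_prime)). Qed.

Lemma red_surj (Q : {mpoly 'F_p[n]}) : exists P : {mpoly int[n]}, red P = Q.
Proof.
elim/mpolyind: Q => [|a m Q _ _ [P <-]]; first by exists 0; rewrite rmorph0.
exists ((a : nat)%:Z *: 'X_[m] + P).
by rewrite rmorphD /= map_mpolyZ map_mpolyX /= -pmulrn natr_Zp.
Qed.

Lemma red_ker (P : {mpoly int[n]}) : red P = 0 -> exists Q, P = Q * p%:R.
Proof.
move=> P0; exists (\sum_(m <- msupp P) (P@_m %/ p)%Z *: 'X_[m]).
rewrite {1}[P]mpolyE mulr_suml; apply: eq_bigr => m _.
have /divzK {1}<- : (p %| P@_m)%Z.
  by rewrite -intr_Fp_eq0 -mcoeff_map_mpoly P0 mcoeff0.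
by rewrite mulr_natr -scaler_nat scalerA mulrC pmulrn intz.
Qed.

Lemma fermat_intz (z : int) : (p%:Z %| z ^+ p - z)%Z.
Proof.
rewrite -intr_Fp_eq0 rmorphB rmorphXn /=.
by have := expf_card (z%:~R : 'F_p); rewrite card_Fp // => ->; rewrite subrr.
Qed.

(** Reduction modulo p turns divisibility of all values into vanishing on
    'F_p^n; the coefficients U_i found over 'F_p are lifted to the integers,
    and the error is a polynomial with coefficients divisible by p. *)
Theorem mpoly_dvd_values (P : {mpoly int[n]}) :
  (forall c : 'I_n -> int, (p%:Z %| P.@[c])%Z) <->
  exists (U0 : {mpoly int[n]}) (U : 'I_n -> {mpoly int[n]}),
    P = U0 * p%:R + \sum_(i < n) U i * ('X_i ^+ p - 'X_i).
Proof.
split=> [Pp | [U0 [U ->]] c]; last first.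
  rewrite mevalD mevalM rmorph_nat rpredD //.
    by rewrite pmulrn intz dvdz_mull.
  rewrite rmorph_sum rpred_sum // => i _.
  by rewrite /= mevalM mevalB rmorphXn /= mevalXU dvdz_mull // fermat_intz.
have [c|V defP] := @vanishing_mpoly_frobenius_ideal 'F_p n (red P).
  rewrite -(meval_eq (v1 := fun i => ((c i : nat)%:Z)%:~R)) => [|i].
    by rewrite meval_map_int; apply/eqP; rewrite intr_Fp_eq0.
  by rewrite -pmulrn natr_Zp.
have [U defU] : exists U : 'I_n -> {mpoly int[n]}, forall i, red (U i) = V i.
  exact: (fin_all_exists (fun i => red_surj (V i))).
have [|U0 defU0] := @red_ker (P - \sum_i U i * ('X_i ^+ p - 'X_i)).
  rewrite rmorphB rmorph_sum /= defP card_Fp //; apply/eqP; rewrite subr_eq0.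
  apply/eqP/eq_bigr => i _.
  by rewrite rmorphM rmorphB rmorphXn /= map_mpolyX defU.
by exists U0, U; rewrite -defU0 subrK.
Qed.

End ReductionModP.

(** * Discriminants of integers of a number field *)

Section NumberField.

Variables (K : fieldExtType rat) (n : nat).
Hypothesis degK : \dim {:K} = n.
Variable xi : 'I_n -> K.
Hypothesis xi_basis : integral_basis xi.

Definition int_comb (c : 'I_n -> int) : K := \sum_(i < n) (c i)%:~R * xi i.

Lemma integral_int_comb c : is_algebraic_integer (int_comb c).
Proof.
rewrite /is_algebraic_integer /int_comb.
apply: big_ind => [|x y|i _]; first exact: integral0.
  exact: integral_add.
by apply: integral_mul; [exact: integral_id | exact: xi_basis.1].
Qed.

Lemma integralX (x : K) k : is_algebraic_integer x ->
  is_algebraic_integer (x ^+ k).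
Proof.
move=> intx; elim: k => [|k IHk]; first exact: integral1.
by rewrite exprS; apply: integral_mul.
Qed.

Lemma integral_int_combP x : is_algebraic_integer x ->
  exists c, x = int_comb c.
Proof.
by move=> /xi_basis.2[a [-> _]]; exists (fun i => a 0 i).
Qed.

Lemma int_comb_eq0 c : int_comb c = 0 -> forall i, c i = 0.
Proof.
have [a [_ uniq_a]] := xi_basis.2 0 (integral0 _).
have a0 : a = 0 by apply: uniq_a; rewrite big1 // => i _; rewrite mxE mul0r.
move=> c0 i; have := uniq_a (\row_j c j).
rewrite a0 => /(_ _)/matrixP/(_ 0 i); rewrite !mxE => <- //.
by rewrite -[LHS]c0; apply: eq_bigr => j _; rewrite mxE.
Qed.

(** A rational relation between the xi_i becomes an integral one after
    multiplication by the denominators, so the n elements xi_i are linearly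
    independent, and n is the dimension of K. *)
Lemma integral_basis_span : (<<[seq xi i | i : 'I_n]>> = fullv)%VS.
Proof.
pose X := [tuple xi i | i < n].
have nthX (i : 'I_n) : X`_i = xi i by rewrite -tnth_nth tnth_mktuple.
suff freeX : free X.
  by apply: span_basis; rewrite basisEfree freeX subvf degK (size_tuple X) leqnn.
apply/freeP => k k0 i.
(* d j * numq (k j) is k j times the product of all the denominators. *)
pose d j := \prod_(l < n | l != j) denq (k l).
have /int_comb_eq0/(_ i)/eqP : int_comb (fun j => d j * numq (k j)) = 0.
  have -> : int_comb (fun j => d j * numq (k j)) =
            (\prod_l denq (k l))%:~R *: \sum_j k j *: X`_j.
    rewrite scaler_sumr; apply: eq_bigr => j _.
    rewrite nthX scalerA (bigD1 j) //= -/(d j) mulrzl -scaler_int.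
    by rewrite !intrM numqE; congr (_ *: _); rewrite mulrA -[RHS]mulrA mulrC.
  by rewrite k0 scaler0.
rewrite mulf_eq0 numq_eq0 => /orP[|/eqP//].
by rewrite prodf_seq_eq0 => /hasP[l _]; rewrite (negPf (denq_neq0 _)) andbF.
Qed.

Variable sigma : 'I_n -> {rmorphism K -> algC}.
Hypothesis sigma_all : all_embeddings sigma.

Lemma embedding_eq_on_basis i j :
  (forall k, sigma i (xi k) = sigma j (xi k)) -> i = j.
Proof.
move=> eq_ij; apply: sigma_all.1 => x.
have : x \in <<[seq xi k | k : 'I_n]>>%VS by rewrite integral_basis_span memvf.
pose X := [tuple xi i | i < n].
rewrite -[[seq _ | _ : _]]/(X : seq K) => /coord_span ->.
rewrite !rmorph_sum; apply: eq_bigr => k _ /=.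
rewrite -[X`_k](tnth_nth 0) tnth_mktuple -mulr_algl !rmorphM eq_ij.
by congr (_ * _); rewrite -!in_algE -!/((sigma _ \o in_alg K) _) !fmorph_eq_rat.
Qed.

(** Distinct embeddings have distinct conjugate forms, since these forms have
    the conjugates of the xi_k as coefficients. *)
Lemma fundamental_discriminant_neq0 : fundamental_discriminant sigma xi != 0.
Proof.
apply/prodf_neq0 => i _; apply/prodf_neq0 => j lt_ij.
rewrite expf_neq0 // subr_eq0; apply: contraTneq lt_ij => eq_w.
suff -> : i = j by rewrite ltnn.
apply: embedding_eq_on_basis => k.
have coefw l : (fundamental_conjugate sigma xi l)@_U_(k) = sigma l (xi k).
  rewrite /fundamental_conjugate raddf_sum (bigD1 k) //= big1 => [|m neq_mk].
    by rewrite mcoeffCM mcoeffXU eqxx mulr1 addr0.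
  by rewrite mcoeffCM mcoeffXU (negPf neq_mk) mulr0.
by rewrite -!coefw eq_w.
Qed.

(** The Vandermonde determinant of the conjugates of x is the product of
    det a and the determinant of the conjugates of the basis. *)
Lemma root_discriminant_powers (c : 'I_n -> int) (a : 'M[int]_n) :
    (forall k : 'I_n,
       int_comb c ^+ k = \sum_(i < n) (a i k)%:~R * xi i) ->
  root_discriminant (fun j => sigma j (int_comb c)) =
    (\det a)%:~R ^+ 2 * field_discriminant sigma xi.
Proof.
move=> powc; pose v : 'rV[algC]_n := \row_j sigma j (int_comb c).
have -> : root_discriminant (fun j => sigma j (int_comb c)) =
          \det (Vandermonde n v) ^+ 2.
  rewrite det_Vandermonde -prodrXl; apply: eq_bigr => i _.
  by rewrite -prodrXl; apply: eq_bigr => j _; rewrite !mxE -sqrrN opprB.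
have -> : Vandermonde n v =
    (map_mx intr a)^T *m \matrix_(i < n, j < n) sigma j (xi i).
  apply/matrixP => k j; rewrite !mxE -rmorphXn powc rmorph_sum.
  by apply: eq_bigr => i _; rewrite !mxE rmorphM rmorph_int.
by rewrite det_mulmx det_tr det_map_mx exprMn.
Qed.

Lemma meval_fundamental_discriminant (c : 'I_n -> int) :
  (fundamental_discriminant sigma xi).@[fun i => (c i)%:~R] =
  root_discriminant (fun j => sigma j (int_comb c)).
Proof.
rewrite /fundamental_discriminant /root_discriminant rmorph_prod.
apply: eq_bigr => i _; rewrite rmorph_prod; apply: eq_bigr => j _ /=.
have evw l : (fundamental_conjugate sigma xi l).@[fun i => (c i)%:~R] =
             sigma l (int_comb c).
  rewrite !rmorph_sum; apply: eq_bigr => k _ /=.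
  by rewrite mevalM mevalC mevalXU rmorphM rmorph_int mulrC.
by rewrite rmorphXn /= mevalB !evw.
Qed.

Variable Delta : {mpoly int[n]}.
Hypothesis DeltaP : is_fundamental_Delta sigma xi Delta.

(** Both sides times the field discriminant are the discriminant of the
    conjugates of [int_comb c]; Delta being determined only up to sign, the
    squares cannot be removed. *)
Lemma Delta_det_powers (c : 'I_n -> int) (a : 'M[int]_n) :
    (forall k : 'I_n,
       int_comb c ^+ k = \sum_(i < n) (a i k)%:~R * xi i) ->
  Delta.@[c] ^+ 2 = \det a ^+ 2.
Proof.
move=> /root_discriminant_powers; rewrite -meval_fundamental_discriminant.
have [_ _ defD] := DeltaP.
have D_neq0 : field_discriminant sigma xi != 0.
  apply: contraNneq fundamental_discriminant_neq0 => D0.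
  by rewrite defD D0 mpolyC0 mulr0.
rewrite defD mevalM mevalC rmorphXn /= meval_map_int => /(mulIf D_neq0).
by rewrite -!rmorphXn => /intr_inj.
Qed.

End NumberField.

Theorem mainTheorem11 (K : fieldExtType rat) (n : nat)
    (degK : \dim {:K} = n)
    (xi : 'I_n -> K) (xi_basis : integral_basis xi)
    (sigma : 'I_n -> {rmorphism K -> algC}) (sigma_all : all_embeddings sigma)
    (Delta : {mpoly int[n]}) (DeltaP : is_fundamental_Delta sigma xi Delta)
    (p : nat) (p_prime : prime p) :
  common_inessential_divisor xi p <->
  exists (U0 : {mpoly int[n]}) (U : 'I_n -> {mpoly int[n]}),
    Delta = U0 * p%:R + \sum_(i < n) U i * ('X_i ^+ p - 'X_i).
Proof.
rewrite -mpoly_dvd_values //.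
have dvd_sq (z : int) : (p%:Z %| z ^+ 2)%Z = (p%:Z %| z)%Z.
  by rewrite !dvdzE abszX Euclid_dvdX ?andbT.
split=> [p_dvd c | p_dvd x intx a pow_x].
  (* Build the matrix of powers of int_comb c and apply the hypothesis to it. *)
  have int_c k := integralX k (integral_int_comb xi_basis c).
  have ex_b (k : 'I_n) : exists b : 'rV[int]_n,
      int_comb xi c ^+ k = \sum_(i < n) (b 0 i)%:~R * xi i.
    by have [b [-> _]] := xi_basis.2 _ (int_c k); exists b.
  have [b pow_c] := fin_all_exists ex_b.
  pose a : 'M[int]_n := \matrix_(i, k) b k 0 i.
  have pow_a (k : 'I_n) :
      int_comb xi c ^+ k = \sum_(i < n) (a i k)%:~R * xi i.
    by rewrite pow_c; apply: eq_bigr => i _; rewrite mxE.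
  rewrite -dvd_sq (Delta_det_powers degK xi_basis sigma_all DeltaP pow_a) dvd_sq.
  exact: p_dvd (integral_int_comb xi_basis c) _ pow_a.
have [c def_x] := integral_int_combP xi_basis intx; rewrite def_x in pow_x.
by rewrite -dvd_sq -(Delta_det_powers degK xi_basis sigma_all DeltaP pow_x) dvd_sq.
Qed.
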